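(* Let $p_1$ and $p_2$ be homogeneous polynomials on $\mathbb{R}^n$ that are hyperbolic with respect to $e_1\in\mathbb{R}^n$ and $e_2\in\mathbb{R}^n$, respectively. Then $\Lambda_+(p_1,e_1)\cap\Lambda_+(p_2,e_2)$ is a hyperbolicity cone; that is, there exist a linear subspace $L\subseteq\mathbb{R}^n$, a vector $z\in L$, and a homogeneous polynomial $q$ on $L$ that is hyperbolic with respect to $z$, such that $\Lambda_+(p_1,e_1)\cap\Lambda_+(p_2,e_2)=\Lambda_+(q,z)\subseteq L$.
   Context: A homogeneous polynomial $p$ of degree $d\ge 0$ on a finite-dimensional real vector space $V$ is hyperbolic with respect to $e\in V$ if $p(e)>0$ and, for each $x\in V$, the univariate polynomial $t\mapsto p(te-x)$ has only real zeros. Its (closed) hyperbolicity cone is $\Lambda_+(p,e)=\{x\in V : \text{all zeros of } t\mapsto p(te-x) \text{ are nonnegative}\}$, which is a closed convex cone. A positive constant polynomial (degree $0$) is hyperbolic with respect to every vector, and its hyperbolicity cone is all of $V$. A closed convex cone in $\mathbb{R}^n$ that need not be full-dimensional is called a hyperbolicity cone if it equals the hyperbolicity cone of a hyperbolic polynomial defined on a linear subspace $L$ of $\mathbb{R}^n$. *)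

(* Defs.v *)
From HB Require Import structures.
From mathcomp Require Import all_boot all_order all_algebra.
From mathcomp Require Import classical_sets reals complex.
From mathcomp Require Import mpoly.

Set Implicit Arguments.
Unset Strict Implicit.
Unset Printing Implicit Defensive.

Import GRing.Theory Num.Theory.
Local Open Scope ring_scope.
Local Open Scope classical_set_scope.

Section Hyperbolic.
Context {R : realType}.

(* Polynomials on [V] are polynomial functions; since [R] is infinite they
   correspond to formal polynomials in the coordinates of any basis, and the
   choice of basis is irrelevant (see [homogeneous_poly_rVP]). *)
Definition homogeneous_poly (V : vectType R) (d : nat) (p : V -> R) : Prop :=
  exists (m : nat) (b : m.-tuple V) (P : {mpoly R[m]}),
    [/\ basis_of {:V} b, P \is d.-homog &
        forall x : V, p x = P.@[fun i => coord b i x]].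

Definition only_real_zeros (u : {poly R}) : Prop :=
  forall z : R[i], root (map_poly (real_complex R) u) z -> complex.Im z = 0.

(* The polynomial [u] below is unique, as [R] is infinite. *)
Definition hyperbolic (V : vectType R) (p : V -> R) (e : V) : Prop :=
  [/\ exists d : nat, homogeneous_poly d p,
      0 < p e &
      forall x : V, exists2 u : {poly R},
        forall t : R, u.[t] = p (t *: e - x) & only_real_zeros u].

(* Only meant for [hyperbolic p e], when all zeros of [t |-> p (t e - x)] are
   real. *)
Definition hyperbolicity_cone (V : vectType R) (p : V -> R) (e : V) : set V :=
  [set x | forall t : R, p (t *: e - x) = 0 -> 0 <= t].

(* Being a closed convex cone is not required separately: every
   [hyperbolicity_cone q z] with [hyperbolic q z] is one. *)
Definition is_hyperbolicity_cone (V : vectType R) (C : set V) : Prop :=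
  exists (L : {vspace V}) (z : subvs_of L) (q : subvs_of L -> R),
    hyperbolic q z /\ C = vsval @` hyperbolicity_cone q z.

Lemma homogeneous_poly_rVP (n d : nat) (p : 'rV[R]_n -> R) :
  homogeneous_poly d p <->
  exists2 P : {mpoly R[n]}, P \is d.-homog & forall x, p x = P.@[x ord0].
Proof.
split=> [[m [b [P [_ Pd pE]]]]|[P Pd pE]].
  pose l := [tuple \sum_(j < n) coord b i (delta_mx ord0 j) *: 'X_j | i < m]
    : m.-tuple {mpoly R[n]}.
  exists (P \mPo l).
    rewrite comp_mpolyE big_seq; apply: rpred_sum => k Pk; apply: rpredZ.
    have <- : mdeg k = d := dhomog_mf Pd Pk.
    rewrite mdegE.
    have h (i : 'I_m) : tnth l i ^+ k i \is (k i).-homog.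
      rewrite -[X in X.-homog]mul1n; apply: dhomogMn; rewrite tnth_mktuple.
      by apply: rpred_sum => j _; apply: rpredZ; rewrite dhomogX; apply/eqP/mdeg1.
    elim/big_rec2: _ => [|i a c _ IH]; first exact: dhomog1.
    exact: dhomogM.
  move=> x; rewrite pE comp_mpoly_meval; apply: meval_eq => i.
  rewrite tnth_mktuple [in LHS](row_sum_delta x) !raddf_sum /=.
  by apply: eq_bigr => j _; rewrite linearZ mevalZ mevalXU /= mulrC.
pose b := [tuple (delta_mx ord0 i : 'rV[R]_n) | i < n].
have bE (k : 'I_n -> R) : \sum_(i < n) k i *: b`_i = \row_i k i.
  rewrite [RHS]row_sum_delta; apply: eq_bigr => i _.
  by rewrite -tnth_nth tnth_mktuple mxE.
have b_free : free b.
  apply/freeP => k; rewrite bE => /rowP k0 i.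
  by have := k0 i; rewrite !mxE.
have b_basis : basis_of {:'rV[R]_n} b.
  by rewrite basisEfree b_free subvf size_tuple dimvf /dim /= mul1n.
exists n, b, P; split=> // x; rewrite pE; apply: meval_eq => i.
have /coord_basis : basis_of fullv b := b_basis.
by move=> /(_ x (memvf x)) {1}->; rewrite bE mxE.
Qed.

End Hyperbolic.

(* Main.v *)
Require Import Defs.
From mathcomp Require Import all_boot all_order all_algebra.
From mathcomp Require Import boolp classical_sets reals.
From mathcomp Require Import complex mpoly zify ring lra.

(** Let [K] be the intersection of the two cones and [L] its linear span. For each
    of the two polynomials [P], with its direction [e], write
    [P (x + s e) = \sum_k s^k T_k(x)] and let [m] be the least [k] such that [T_k]
    does not vanish on [K]; then [T_k] vanishes on [L] for all [k < m]. Choose [z] in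
    [K] at which neither of the two [T_m] vanishes. On [L], [T_m] is hyperbolic with
    respect to [z], being the limit of [s^-m P (x + s e)] as [s] tends to [0], and
    [K] is the hyperbolicity cone of the product of the two [T_m].

    All information on zeros comes from homotopies: if the zeros of a polynomial
    whose leading coefficient is constant along the path never meet the real axis,
    then those in the open lower half plane stay there. *)

Set Implicit Arguments.
Unset Strict Implicit.
Unset Printing Implicit Defensive.

Import Order.TTheory GRing.Theory Num.Theory.
Local Open Scope ring_scope.
Local Open Scope complex_scope.

(** * Zeros of complex polynomials along a path *)

(** Connectedness of [[0, 1)]: the supremum of the [t] up to which [P] persists inherits [P] from
    points just below it, and could be pushed further if it were below the target [T]. *)
Lemma locally_constant_itv (R : realType) (P : R -> Prop) : P 0 ->
    (forall s, 0 <= s < 1 -> exists2 d, 0 < d &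
       forall t, 0 <= t < 1 -> `|t - s| < d -> P t <-> P s) ->
  forall s, 0 <= s < 1 -> P s.
Proof.
move=> P0 Ploc T /andP[T0 T1].
pose S := [set t : R | 0 <= t <= T /\ forall u, 0 <= u <= t -> P u]%classic.
have S0 : S 0.
  by split=> [|u]; rewrite ?lexx ?T0// -eq_le => /eqP <-.
have supS : has_sup S.
  by split; [exists 0 | exists T => t [/andP[]]].
have s0 : 0 <= sup S by apply: ub_le_sup => //; case: supS.
have sT : sup S <= T by apply: ge_sup => [|t [/andP[]]//]; case: supS.
have /Ploc[d d0 dP] : 0 <= sup S < 1 by rewrite s0 (le_lt_trans sT).
have below u : 0 <= u < sup S -> P u.
  move=> /andP[u0 us].
  have us0 : 0 < sup S - u by rewrite subr_gt0.
  have [t [tT tP]] := sup_adherent us0 supS.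
  by rewrite subKr => ut; apply: tP; rewrite u0 ltW.
have Ps : P (sup S).
  have [t St] := sup_adherent d0 supS.
  have tS : t <= sup S by apply: ub_le_sup => //; case: supS.
  case: St => /andP[t0 tT] tP dt; apply/(dP t).
  - by rewrite t0 (le_lt_trans tT).
  - by rewrite ler0_norm ?subr_le0//; lra.
  - by apply: tP; rewrite t0 lexx.
suff <- : sup S = T by [].
apply/eqP; rewrite eq_le sT /= leNgt; apply/negP => ltsT.
pose t := Num.min T (sup S + d / 2).
have ts : sup S < t by rewrite lt_min ltsT /=; lra.
suff /(ub_le_sup (proj2 supS)) : S t by rewrite leNgt ts.
have [tT td] : t <= T /\ t <= sup S + d / 2 by rewrite !ge_min !lexx orbT.
split=> [|u /andP[u0 ut]]; first by rewrite tT (le_trans s0) // ltW.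
have [us|su|->//] := ltgtP u (sup S); first by apply: below; rewrite u0 us.
apply/(dP u) => //; first by rewrite u0; lra.
by rewrite gtr0_norm ?subr_gt0//; lra.
Qed.

Section ComplexPoly.
Variable R : realType.
Local Notation C := R[i].
Implicit Types (f : {poly C}) (w a : C).

Lemma rcD (x y : R) : (x + y)%:C = x%:C + y%:C.
Proof. exact: rmorphD. Qed.

Lemma rcN (x : R) : (- x)%:C = - x%:C.
Proof. exact: rmorphN. Qed.

Lemma rcM (x y : R) : (x * y)%:C = x%:C * y%:C.
Proof. exact: rmorphM. Qed.

Lemma Re_normE w : (complex.Re `|w|)%:C = `|w|.
Proof. by rewrite RRe_real ?normr_real. Qed.

Lemma gt0_complexP w : 0 < w -> exists2 r : R, 0 < r & w = r%:C.
Proof.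
move=> w0; exists (complex.Re w); last by rewrite RRe_real ?gtr0_real.
by rewrite -ltcR RRe_real ?gtr0_real.
Qed.

Lemma Re_norm_ge0 w : 0 <= complex.Re `|w|.
Proof. by rewrite -ler0c Re_normE. Qed.

Lemma Im_le_norm w : (complex.Im w)%:C <= `|w|.
Proof.
case: w => x y; rewrite normc_def /= lecR.
apply: le_trans (ler_norm y) _; rewrite -sqrtr_sqr.
by apply: ler_wsqrtr; rewrite lerDr sqr_ge0.
Qed.

Lemma poly_factor f d : (size f <= d.+1)%N -> f`_d != 0 ->
  exists2 r : seq C, size r = d &
    forall w, f.[w] = f`_d * \prod_(z <- r) (w - z).
Proof.
move=> sf fd.
have sfE : size f = d.+1.
  by apply/eqP; rewrite eqn_leq sf; apply: contraR fd; rewrite -leqNgt => /leq_sizeP->.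
have [r fr] := closed_field_poly_normal f; exists r.
  have : size f = (size r).+1.
    by rewrite [in LHS]fr size_scale ?size_prod_XsubC// lead_coefE sfE.
  by rewrite sfE => -[].
move=> w; rewrite [in LHS]fr hornerZ lead_coefE sfE horner_prod.
by congr (_ * _); apply: eq_bigr => z _; rewrite !hornerE.
Qed.

(** Each root [z] has [Im z <= 0], so each factor satisfies [|w - z| >= Im w]. The bound depends on
    [f] only through its leading coefficient, hence is uniform over families sharing it. *)
Lemma norm_horner_ge f d w : (size f <= d.+1)%N -> f`_d != 0 ->
    (forall z, 0 < complex.Im z -> f.[z] != 0) -> 0 <= complex.Im w ->
  `|f`_d| * (complex.Im w)%:C ^+ d <= `|f.[w]|.
Proof.
move=> sf fd f0 w0; have [r sr fE] := poly_factor sf fd.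
rewrite fE normrM ler_wpM2l// normr_prod -sr.
have {f0} : {in r, forall z, complex.Im z <= 0}.
  move=> z zr; rewrite leNgt; apply/negP => /f0.
  by rewrite fE (perm_big _ (perm_to_rem zr)) big_cons /= subrr mul0r mulr0 eqxx.
elim: r {fE sr} => [|z r IH] zr; first by rewrite big_nil.
rewrite big_cons /= exprS ler_pM ?exprn_ge0 ?ler0c//.
  apply: le_trans (Im_le_norm _); rewrite lecR raddfB /= lerDl oppr_ge0.
  by apply: zr; rewrite inE eqxx.
by apply: IH => u ur; apply: zr; rewrite inE ur orbT.
Qed.

(** With all roots strictly below the real axis, each factor is at least a multiple of [1 + |w|].
    This growth matches the perturbation bound of [horner2_lipschitz], which makes up for the half
    plane not being compact. *)
Lemma norm_horner_ge_growth f d : (size f <= d.+1)%N -> f`_d != 0 ->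
    (forall z, 0 <= complex.Im z -> f.[z] != 0) ->
  exists2 c : R, 0 < c &
    forall w, 0 <= complex.Im w -> c%:C * (1 + `|w|) ^+ d <= `|f.[w]|.
Proof.
move=> sf fd f0; have [r sr fE] := poly_factor sf fd.
have {f0} : {in r, forall z, complex.Im z < 0}.
  move=> z zr; rewrite ltNge; apply/negP => /f0.
  by rewrite fE (perm_big _ (perm_to_rem zr)) big_cons /= subrr mul0r mulr0 eqxx.
move=> rI.
have [c c0 cP] : exists2 c : R, 0 < c & forall w, 0 <= complex.Im w ->
    c%:C * (1 + `|w|) ^+ d <= \prod_(z <- r) `|w - z|.
  rewrite -sr; elim: r rI {sr fE} => [|z r IH] rI.
    by exists 1 => // w _; rewrite big_nil mulr1.
  have [|c c0 cP] := IH; first by move=> u ur; apply: rI; rewrite inE ur orbT.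
  have zI : complex.Im z < 0 by apply: rI; rewrite inE eqxx.
  pose h := - complex.Im z; have h0 : 0 < h by rewrite oppr_gt0.
  pose b := 1 + complex.Re `|z|.
  have b0 : 0 < b by rewrite ltr_pwDl// Re_norm_ge0.
  (* From [h <= |w - z|] and [1 + |w| <= b + |w - z|] one gets [h (1 + |w|) <= h b + h |w - z| <= (b
     + h) |w - z|]. *)
  exists (c * (h / (b + h))); first by rewrite mulr_gt0// divr_gt0// addr_gt0.
  move=> w Iw; rewrite big_cons /= exprS rcM.
  set k := (h / _)%:C; set X := (_ ^+ _).
  have k0 : 0 <= k by rewrite ler0c ltW// divr_gt0// addr_gt0.
  rewrite [c%:C * k]mulrC mulrACA.
  have X0 : 0 <= X by rewrite exprn_ge0 ?addr_ge0.
  apply: ler_pM; last exact: cP.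
  - by rewrite mulr_ge0 ?addr_ge0.
  - by apply: mulr_ge0 => //; rewrite ler0c ltW.
  have wz : h <= complex.Re `|w - z|.
    rewrite -lecR Re_normE; apply: le_trans (Im_le_norm _).
    by rewrite lecR raddfB /= /h lerDr.
  have wb : 1 + complex.Re `|w| <= b + complex.Re `|w - z|.
    rewrite -lecR !rcD !Re_normE -addrA lerD2l addrC.
    by rewrite -[X in `|X| <= _](subrK z) ler_normD.
  rewrite -[`|w|]Re_normE -[`|w - z|]Re_normE -rcD -rcM lecR.
  have bh0 : 0 < b + h by rewrite addr_gt0.
  rewrite mulrAC ler_pdivrMr//.
  move: wz wb; move: (complex.Re _) (complex.Re _) => N D wz wb.
  clearbody h b; nra.
exists (complex.Re `|f`_d| * c).
  by rewrite mulr_gt0// -ltcR Re_normE normr_gt0.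
move=> w Iw; rewrite fE normrM normr_prod rcM Re_normE.
by rewrite -mulrA ler_wpM2l// cP.
Qed.

(** Both bounds go through the induction together: the Lipschitz estimate for [f * 'X] uses the
    bound on [f]. *)
Lemma horner_lipschitz f : exists2 M : R, 0 < M &
  forall x y : C, `|x| <= 1 -> `|y| <= 1 ->
    `|f.[x]| <= M%:C /\ `|f.[x] - f.[y]| <= M%:C * `|x - y|.
Proof.
elim/poly_ind: f => [|f a [M M0 MP]].
  by exists 1 => // x y _ _; rewrite !horner0 subrr normr0 mul1r ler01.
exists (M + M + complex.Re `|a|).
  by rewrite ltr_wpDr ?addr_gt0// Re_norm_ge0.
move=> x y x1 y1; have [fx _] := MP _ _ x1 x1; have [fy fxy] := MP _ _ y1 x1.
have M0' : 0 <= M%:C by rewrite ler0c ltW.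
rewrite !hornerE !rcD Re_normE; split.
  apply: le_trans (ler_normD _ _) _; rewrite lerD2r normrM.
  by apply: (@le_trans _ _ M%:C); rewrite ?lerDl// -[leRHS]mulr1 ler_pM.
rewrite opprD addrACA subrr addr0.
rewrite (_ : _ - _ = f.[x] * (x - y) - (f.[y] - f.[x]) * y); last by ring.
apply: le_trans (ler_normB _ _) _.
rewrite [leRHS]mulrDl ler_wpDr ?mulr_ge0// [leRHS]mulrDl !normrM lerD ?ler_wpM2r//.
by rewrite -[leRHS]mulr1 ler_pM// [`|x - y|]distrC.
Qed.

Lemma horner2_lipschitz (F : {poly {poly C}}) d : (size F <= d.+1)%N ->
  exists2 M : R, 0 < M &
  forall x y w : C, `|x| <= 1 -> `|y| <= 1 ->
    `|F.[w%:P].[x] - F.[w%:P].[y]| <= M%:C * `|x - y| * (1 + `|w|) ^+ d.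
Proof.
move=> sF.
suff /(_ d.+1)[//|M M0 MP] k : (k <= d.+1)%N -> exists2 M : R, 0 < M &
    forall x y w : C, `|x| <= 1 -> `|y| <= 1 ->
    `|(\sum_(i < k) F`_i * w%:P ^+ i).[x]
      - (\sum_(i < k) F`_i * w%:P ^+ i).[y]|
      <= M%:C * `|x - y| * (1 + `|w|) ^+ d.
  by exists M => // x y w x1 y1; rewrite (horner_coef_wide _ sF) MP.
elim: k => [_|k IH kd].
  exists 1 => // x y w _ _; rewrite !big_ord0 !horner0 subrr normr0.
  by rewrite !mulr_ge0 ?exprn_ge0 ?addr_ge0.
have [M M0 MP] := IH (ltnW kd).
have [N N0 NP] := horner_lipschitz F`_k.
exists (M + N); rewrite ?addr_gt0// => x y w x1 y1.
rewrite !big_ord_recr /= !hornerD opprD addrACA rcD !mulrDl.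
apply: le_trans (ler_normD _ _) _; rewrite lerD ?MP//.
rewrite !hornerM -!rmorphXn !hornerC -mulrBl normrM normrX.
have [_ NPxy] := NP _ _ x1 y1; apply: ler_pM; rewrite ?exprn_ge0//.
apply: (@le_trans _ _ ((1 + `|w|) ^+ k)).
  by rewrite lerXn2r ?nnegrE ?addr_ge0// lerDr.
by apply: ler_weXn2l; rewrite ?lerDl// -ltnS.
Qed.

(** The outer variable is the unknown [w], the inner one the time [s]. Having no zero in the closed
    upper half plane is both an open and a closed condition on [s] in [[0, 1)]. At [s = 1] real
    zeros may appear, so only the open half plane is covered. *)
Lemma half_plane_homotopy (F : {poly {poly C}}) d a :
    (size F <= d.+1)%N -> F`_d = a%:P -> a != 0 ->
    (forall s : R, 0 <= s < 1 -> forall w : R, F.[w%:C%:P].[s%:C] != 0) ->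
    (forall w, 0 <= complex.Im w -> F.[w%:P].[0] != 0) ->
  forall w, 0 < complex.Im w -> F.[w%:P].[1] != 0.
Proof.
move=> sF Fd a0 Freal F0.
pose G s : {poly C} := map_poly (horner_eval s) F.
have GE s w : (G s).[w] = F.[w%:P].[s].
  by rewrite -[w in LHS](hornerC w s) -[_.[s] in LHS]horner_evalE horner_map.
have sG s : (size (G s) <= d.+1)%N by rewrite (leq_trans (size_poly _ _)).
have Gd s : (G s)`_d = a by rewrite coef_map Fd /= horner_evalE hornerC.
have Gd0 s : (G s)`_d != 0 by rewrite Gd.
have [M M0 MP] := horner2_lipschitz sF.
have ler1c (s : R) : 0 <= s < 1 -> `|s%:C| <= 1.
  by move=> /andP[s0 s1]; rewrite ger0_norm ?ler0c// -[1]/(1%:C) lecR ltW.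
have rcB (s t : R) : s%:C - t%:C = (s - t)%:C by rewrite rcD rcN.
have norm_rc (s : R) : `|s%:C| = `|s|%:C by rewrite normc_def /= expr0n addr0 sqrtr_sqr.
(* If [G s] vanishes at [w] and [G t] has no zero in the open upper half plane, then [|a| (Im w)^d
   <= |G t (w) - G s (w)| <= M |t - s| (1 + |w|)^d], so [t] stays away from [s]. *)
have away (w s : C) : 0 < complex.Im w -> `|s| <= 1 -> (G s).[w] = 0 ->
    exists2 e : R, 0 < e & forall t : C, `|t| <= 1 ->
      (forall z, 0 < complex.Im z -> (G t).[z] != 0) -> e%:C <= `|t - s|.
  move=> w0 s1 sw.
  have y0 : 0 < M%:C * (1 + `|w|) ^+ d.
    by rewrite mulr_gt0 ?ltcR// exprn_gt0// ltr_pwDl.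
  have : 0 < `|a| * (complex.Im w)%:C ^+ d / (M%:C * (1 + `|w|) ^+ d).
    by rewrite divr_gt0// mulr_gt0 ?normr_gt0// exprn_gt0// ltcR.
  move=> /gt0_complexP[e e0 eE]; exists e => // t t1 tP.
  rewrite -eE ler_pdivrMr//.
  have := norm_horner_ge (sG t) (Gd0 t) tP (ltW w0).
  rewrite Gd GE => /le_trans; apply.
  rewrite -[F.[_].[_]]subr0 -sw GE mulrA [`|t - s| * _]mulrC.
  exact: MP.
pose P (s : R) := forall w, 0 <= complex.Im w -> (G s%:C).[w] != 0.
have PG s : 0 <= s < 1 -> P s.
  apply: locally_constant_itv => [w w0|{}s s01]; first by rewrite GE F0.
  (* If [P s] fails, the zero found is not real and [away] makes [P] fail nearby. If [P s] holds,
     the growth bound exceeds the perturbation as long as [|t - s| < c / M]. *)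
  have [Ps|/existsNP[w /not_implyP[w0 /negP]]] := pselect (P s); last first.
    rewrite negbK => /eqP sw.
    have {}w0 : 0 < complex.Im w.
      rewrite lt_neqAle w0 andbT eq_sym; apply/eqP => w0'.
      have := Freal _ s01 (complex.Re w); rewrite -GE.
      suff -> : (complex.Re w)%:C = w by rewrite sw eqxx.
      by case: w w0' {w0 sw} => x y /= ->.
    have [e e0 eP] := away _ _ w0 (ler1c _ s01) sw.
    exists e => // t t01 ts; split=> [Pt|/(_ w (ltW w0))]; last by rewrite sw eqxx.
    have := eP t%:C (ler1c _ t01) (fun z z0 => Pt z (ltW z0)).
    by rewrite rcB norm_rc lecR leNgt ts.
  have [c c0 cP] := norm_horner_ge_growth (sG s%:C) (Gd0 _) Ps.
  exists (c / M) => [|t t01 ts]; first by rewrite divr_gt0.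
  split=> // _ w w0; apply: contraTneq ts => tw; rewrite -leNgt ler_pdivrMr//.
  rewrite -lecR rcM -norm_rc -rcB distrC mulrC.
  have w1 : 0 < (1 + `|w|) ^+ d by rewrite exprn_gt0// ltr_pwDl.
  rewrite -(ler_pM2r w1); apply: le_trans (cP _ w0) _.
  by rewrite -[(G _).[w]]subr0 -tw !GE MP ?ler1c.
move=> w w0; rewrite -GE; apply/eqP => w1.
have [|e e0 eP] := away _ _ w0 _ w1; first by rewrite normr1.
pose t := Num.max 0 (1 - e / 2).
have [t0 te] : 0 <= t /\ 1 - e / 2 <= t by rewrite !le_max !lexx orbT.
have t1 : t < 1 by rewrite gt_max ltr01/=; lra.
have t01 : 0 <= t < 1 by rewrite t0.
have := eP t%:C (ler1c _ t01) (fun z z0 => PG t t01 z (ltW z0)).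
rewrite -[1]/(1%:C) rcB norm_rc lecR ltr0_norm ?subr_lt0//; lra.
Qed.

Lemma poly_nonzero_limit (c : {poly C}) : 
    (exists2 e : R, 0 < e & forall s : R, 0 < s <= 1 -> e%:C <= `|c.[s%:C]|) ->
  c.[0] != 0.
Proof.
move=> [e e0 ec]; apply/eqP => c0.
have [M M0 MP] := horner_lipschitz c.
(* If [c] vanished at [0], its norm at this [s] would be at most [M s <= e / 2]. *)
pose s := Num.min 1 (e / (M + M)).
have s0 : 0 < s by rewrite lt_min ltr01 divr_gt0// addr_gt0.
have [s1 se] : s <= 1 /\ s <= e / (M + M) by rewrite !ge_min !lexx orbT.
have ns : `|s%:C| = s%:C by rewrite gtr0_norm ?ltcR.
have := MP s%:C 0; rewrite c0 !subr0 normr0 ns -[1]/(1%:C) !lecR s1 ler01.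
move=> /(_ isT isT)[_ /(le_trans (ec _ _))]; rewrite s0 s1 -rcM lecR => /(_ isT).
move: se; rewrite ler_pdivlMr ?addr_gt0//; nra.
Qed.

End ComplexPoly.

(** * Polynomials restricted to lines *)

Section Line.
Variables (n : nat) (R0 : comNzRingType).
Implicit Types (S : comNzRingType) (P : {mpoly R0[n]}).

(** Graded induction on a form, relating two evaluations of it: [K k] compares values of degree [k].
    Statements about one evaluation take a [K] that ignores its last argument. *)
Lemma mmap_dhomog_ind S1 S2 (K : nat -> S1 -> S2 -> Prop)
    (f1 : R0 -> S1) (h1 : 'I_n -> S1) (f2 : R0 -> S2) (h2 : 'I_n -> S2) d P :
    (forall k, K k 0 0) ->
    (forall k x1 x2 y1 y2, K k x1 x2 -> K k y1 y2 -> K k (x1 + y1) (x2 + y2)) ->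
    K 0 1 1 ->
    (forall k l x1 x2 y1 y2, K k x1 x2 -> K l y1 y2 ->
       K (k + l)%N (x1 * y1) (x2 * y2)) ->
    (forall c, K 0 (f1 c) (f2 c)) -> (forall i, K 1 (h1 i) (h2 i)) ->
  P \is d.-homog -> K d (mmap f1 h1 P) (mmap f2 h2 P).
Proof.
move=> K0 KD K1 KM Kf Kh Pd; rewrite /mmap !big_seq.
apply: (big_ind2 (K d)) => // [x1 x2 y1 y2|m mP]; first exact: KD.
have -> : d = (0 + \sum_i m i)%N by rewrite -mdegE (dhomog_mf Pd mP).
apply: (KM) => //; rewrite /mmap1.
apply: (big_ind3 K) => // [a1 b1 c1 a2 b2 c2|i _]; first exact: KM.
elim: (m i) => [|k IH]; first by rewrite !expr0.
by rewrite !exprS -add1n; apply: (KM).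
Qed.

Definition evalv S (f : R0 -> S) (v : 'rV[S]_n) P : S := mmap f (v 0) P.

Definition line S (f : R0 -> S) (A B : 'rV[S]_n) P : {poly S} :=
  mmap (fun c => (f c)%:P) (fun i => (A 0 i)%:P + (B 0 i)%:P * 'X) P.

Lemma rmorph_mmap (S S' : comNzRingType) (g : {rmorphism S -> S'}) f h f' h' P :
  (forall c, g (f c) = f' c) -> (forall i, g (h i) = h' i) ->
  g (mmap f h P) = mmap f' h' P.
Proof.
move=> gf gh; rewrite /mmap rmorph_sum; apply: eq_bigr => m _.
rewrite rmorphM gf rmorph_prod; congr (_ * _); apply: eq_bigr => i _.
by rewrite rmorphXn gh.
Qed.

Lemma evalvM S (f : {rmorphism R0 -> S}) v P Q :
  evalv f v (P * Q) = evalv f v P * evalv f v Q.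
Proof. exact: rmorphM. Qed.

Lemma evalv_scale S (f : {rmorphism R0 -> S}) v c P :
  evalv f v (c *: P) = f c * evalv f v P.
Proof. exact: mmapZ. Qed.

Lemma rmorph_evalv S S' (g : {rmorphism S -> S'}) f v P :
  g (evalv f v P) = evalv (g \o f) (map_mx g v) P.
Proof. by apply: rmorph_mmap => // i; rewrite mxE. Qed.

Lemma horner_line S f (A B : 'rV[S]_n) P t :
  (line f A B P).[t] = evalv f (A + t *: B) P.
Proof.
rewrite -horner_evalE; apply: rmorph_mmap => [c|i]; rewrite /= ?horner_evalE.
  by rewrite hornerC.
by rewrite !hornerE !mxE mulrC.
Qed.

Lemma map_line S S' (g : {rmorphism S -> S'}) f A B P :
  map_poly g (line f A B P) = line (g \o f) (map_mx g A) (map_mx g B) P.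
Proof.
apply: rmorph_mmap => [c|i]; first by rewrite /= map_polyC.
by rewrite rmorphD rmorphM /= !map_polyC map_polyX !mxE.
Qed.

Lemma line_lead S f (A B : 'rV[S]_n) d P : P \is d.-homog ->
  (size (line f A B P) <= d.+1)%N /\ (line f A B P)`_d = evalv f B P.
Proof.
pose K k (p : {poly S}) c := (size p <= k.+1)%N /\ p`_k = c.
move=> Pd; suff : K d (line f A B P) (evalv f B P) by [].
apply: (mmap_dhomog_ind (K := K)) Pd => {d} [k|k x1 x2 y1 y2|||c|i]; rewrite /K.
- by rewrite size_poly0 coef0.
- move=> [sx <-] [sy <-]; rewrite coefD; split=> //.
  by rewrite (leq_trans (size_polyD _ _))// geq_max sx.
- by rewrite size_poly1 coef1.
- move=> k l x1 x2 y1 y2 [sx <-] [sy <-]; split.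
    apply: leq_trans (size_polyMleq _ _) _.
    by lia.
  have kl : (k < (k + l).+1)%N by rewrite ltnS leq_addr.
  rewrite coefM (bigD1 (Ordinal kl))//= addKn big1 ?addr0// => i.
  rewrite -val_eqE /= neq_ltn => /orP[ik|ki].
    by rewrite [y1`__]nth_default ?mulr0// (leq_trans sy)// ltn_subRL ltn_add2r.
  by rewrite nth_default ?mul0r// (leq_trans sx).
- by rewrite size_polyC coefC eqxx; split=> //; case: (_ != _).
- split; last by rewrite coefD coefC coefMX /= coefC add0r.
  rewrite (leq_trans (size_polyD _ _))// geq_max (leq_trans (size_polyC_leq1 _))//=.
  by rewrite (leq_trans (size_polyMleq _ _))// size_polyX addn2 /= ltnS size_polyC_leq1.
Qed.

Lemma evalvZ S (f : R0 -> S) (v : 'rV[S]_n) d P a : P \is d.-homog ->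
  evalv f (a *: v) P = a ^+ d * evalv f v P.
Proof.
pose K k (x y : S) := x = a ^+ k * y.
move=> Pd; suff : K d (evalv f (a *: v) P) (evalv f v P) by [].
apply: (mmap_dhomog_ind (K := K)) Pd => {d} [k|k x1 x2 y1 y2 -> ->|||c|i]; rewrite /K.
- by rewrite mulr0.
- by rewrite mulrDr.
- by rewrite expr0 mulr1.
- by move=> k l x1 x2 y1 y2 -> ->; rewrite exprD mulrACA.
- by rewrite expr0 mul1r.
- by rewrite mxE.
Qed.

End Line.

(** * Taylor coefficients in a fixed direction *)

Section Taylor.
Variables (n : nat) (R : comNzRingType).
Implicit Types (P : {mpoly R[n]}) (e : 'rV[R]_n).

(** This is [T_k] as a formal polynomial: the line in direction [e] starts at the generic point,
    whose coordinates are the variables. *)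
Definition taylor_coef P e k : {mpoly R[n]} :=
  (line (@mpolyC n R) (\row_i 'X_i) (map_mx (@mpolyC n R) e) P)`_k.

Lemma evalv_taylor_coef (S : comNzRingType) (f : {rmorphism R -> S}) v P e k :
  evalv f v (taylor_coef P e k) = (line f v (map_mx f e) P)`_k.
Proof.
rewrite /evalv /taylor_coef -[LHS]coef_map map_line.
suff [-> -> ->] : [/\ mmap f (v 0) \o @mpolyC n R = f,
    map_mx (mmap f (v 0)) (\row_i 'X_i) = v &
    map_mx (mmap f (v 0)) (map_mx (@mpolyC n R) e) = map_mx f e] by [].
split; [apply/funext => c /=|apply/rowP => i|apply/rowP => i]; rewrite ?mxE ?mmapC//.
by rewrite mmapX mmap1U.
Qed.

Lemma taylor_coef_dhomog P e d k : P \is d.-homog ->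
  taylor_coef P e k \is (d - k).-homog.
Proof.
move=> Pd.
have dhomogC c : c%:MP \is [in R[n], 0.-homog].
  by rewrite -alg_mpolyC; apply/dhomogZ/dhomog1.
(* [P (x + s e)] is homogeneous jointly in [x] and [s]. The size bound is carried along because
   subtraction is truncated: coefficients beyond degree [l] must be known to vanish. *)
pose K l (p : {poly {mpoly R[n]}}) (_ : R) :=
  (size p <= l.+1)%N /\ forall i, p`_i \is (l - i).-homog.
suff : K d (line (@mpolyC n R) (\row_i 'X_i) (map_mx (@mpolyC n R) e) P)
  (mmap id (fun=> 0) P) by case=> _; apply.
apply: (mmap_dhomog_ind (K := K)) => // {d P Pd} [l|l x x' y y'|||c|i].
- by split=> [|i]; rewrite ?size_poly0// coef0 dhomog0.
- move=> [sx hx] [sy hy]; split=> [|i]; last by rewrite coefD dhomogD.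
  by rewrite (leq_trans (size_polyD _ _))// geq_max sx.
- split=> [|i]; first by rewrite size_poly1.
  by rewrite coef1; case: (i == _); rewrite ?dhomog0 ?dhomog1.
- move=> l j x x' y y' [sx hx] [sy hy]; split=> [|i].
    apply: leq_trans (size_polyMleq _ _) _.
    by lia.
  rewrite coefM; apply: rpred_sum => u _.
  have [ul|lu] := leqP u l; last by rewrite nth_default ?mul0r ?dhomog0// (leq_trans sx).
  have [uj|ju] := leqP (i - u)%N j; last first.
    by rewrite [y`__]nth_default ?mulr0 ?dhomog0// (leq_trans sy).
  have -> : (l + j - i = (l - u) + (j - (i - u)))%N.
    by have := ltn_ord u; rewrite ltnS; lia.
  exact: dhomogM.
- split=> [|i]; first by rewrite size_polyC; case: (_ != _).
  by rewrite coefC; case: (i == _); rewrite ?dhomog0// sub0n dhomogC.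
- split=> [|j].
    rewrite (leq_trans (size_polyD _ _))// geq_max (leq_trans (size_polyC_leq1 _))//=.
    by rewrite (leq_trans (size_polyMleq _ _))// size_polyX addn2 /= ltnS size_polyC_leq1.
  rewrite coefD coefC coefMX coefC !mxE.
  case: j => [|[|j]] /=; rewrite ?addr0 ?add0r ?dhomog0//.
  by rewrite dhomogX; apply/eqP/mdeg1.
Qed.

End Taylor.

(** * Hyperbolicity cones *)

Local Opaque evalv line.

Lemma poly_eq0_injective (F : idomainType) (p : {poly F}) (u : nat -> F) :
  injective u -> (forall j, p.[u j] = 0) -> p = 0.
Proof.
move=> uI pu; apply: (@roots_geq_poly_eq0 _ _ (map u (iota 0 (size p)))).
- by apply/allP => _ /mapP[j _ ->]; rewrite rootE pu.
- by rewrite map_inj_uniq ?iota_uniq.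
- by rewrite size_map size_iota.
Qed.

Section Complexification.
Variables (R : realType) (n : nat).
Local Notation C := R[i].
Local Notation cx := (map_mx (real_complex R)).
Local Notation evC := (evalv (real_complex R)).
Local Notation evR := (evalv (@idfun R)).
Implicit Types (P : {mpoly R[n]}) (x y z e : 'rV[R]_n) (A B : 'rV[C]_n).

Lemma evC_real P x : evC (cx x) P = (evR x P)%:C.
Proof. exact/esym/(rmorph_evalv (real_complex R) idfun). Qed.

Lemma evC_real_eq0 P x : (evC (cx x) P == 0) = (evR x P == 0).
Proof. by rewrite evC_real -[0]/(0%:C) (inj_eq (@complexI R)). Qed.

Lemma horner_map_line P x y w :
  (map_poly (real_complex R) (line idfun x y P)).[w] = evC (cx x + w *: cx y) P.
Proof. by rewrite map_line horner_line. Qed.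

(** This is [P (A0 + s A1 + w B)] with [w] outer and [s] inner, as [half_plane_homotopy] expects. *)
Definition pencil A0 A1 B P : {poly {poly C}} :=
  line (fun c : R => (c%:C)%:P) (map_mx polyC A0 + 'X *: map_mx polyC A1)
    (map_mx polyC B) P.

Lemma horner_pencil A0 A1 B P w s :
  (pencil A0 A1 B P).[w%:P].[s] = evC (A0 + s *: A1 + w *: B) P.
Proof.
rewrite horner_line -horner_evalE [LHS]rmorph_evalv.
congr (evalv _ _ P); first by apply/funext => c; rewrite /= horner_evalE hornerC.
by apply/rowP => i; rewrite !mxE /= horner_evalE !hornerE.
Qed.

Lemma coef_pencil A0 A1 e P k s :
  ((pencil A0 A1 (cx e) P)`_k).[s] = evC (A0 + s *: A1) (taylor_coef P e k).
Proof.
rewrite (evalv_taylor_coef (real_complex R)) -horner_evalE -coef_map map_line.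
congr ((line _ _ _ P)`_k).
- by apply/funext => c; rewrite /= horner_evalE hornerC.
- by apply/rowP => i; rewrite !mxE /= horner_evalE !hornerE.
- by apply/rowP => i; rewrite !mxE /= horner_evalE !hornerE.
Qed.

Lemma pencil_lead A0 A1 B d P : P \is d.-homog ->
  (size (pencil A0 A1 B P) <= d.+1)%N /\
  (pencil A0 A1 B P)`_d = (evC B P)%:P.
Proof.
move=> Pd; have [sF ->] := line_lead (fun c : R => (c%:C)%:P)
  (map_mx polyC A0 + 'X *: map_mx polyC A1) (map_mx polyC B) Pd.
by split=> //; apply/esym/(rmorph_evalv (@polyC C) (real_complex R)).
Qed.

(** The leading coefficient in [w] is [P (B)], constant along the path. *)
Lemma dhomog_homotopy d P A0 A1 B : P \is d.-homog -> evC B P != 0 ->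
    (forall s : R, 0 <= s < 1 -> forall w : R,
       evC (A0 + s%:C *: A1 + w%:C *: B) P != 0) ->
    (forall w, 0 <= complex.Im w -> evC (A0 + w *: B) P != 0) ->
  forall w, 0 < complex.Im w -> evC (A0 + A1 + w *: B) P != 0.
Proof.
move=> Pd B0 real0 start w w0; have [sF Fd] := pencil_lead A0 A1 B Pd.
rewrite -[A1]scale1r -horner_pencil.
apply: (half_plane_homotopy sF Fd B0) => // [s s01 u|u u0].
  by rewrite horner_pencil real0.
by rewrite horner_pencil scale0r addr0 start.
Qed.

(** * Stability of a hyperbolic form and convexity of its cone *)

Section Cone.
Variables (d : nat) (P : {mpoly R[n]}) (e : 'rV[R]_n).
Hypotheses (Pd : P \is d.-homog) (Pe : evR e P != 0).
Hypothesis Preal : forall x s, evC (cx x + s *: cx e) P = 0 -> s \is Num.real.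

(* In the order of [R[i]], [s <= 0] entails that [s] is real. *)
Definition ccone x := forall s, evC (cx x + s *: cx e) P = 0 -> s <= 0.

Lemma evC_nonreal x s : complex.Im s != 0 -> evC (cx x + s *: cx e) P != 0.
Proof.
by apply: contraNneq => /Preal; case: s => a b; rewrite complex_real.
Qed.

Lemma evC_e_neq0 s : s != 0 -> evC (s *: cx e) P != 0.
Proof.
by move=> s0; rewrite (evalvZ _ _ _ Pd) mulf_neq0 ?expf_neq0// evC_real_eq0.
Qed.

Lemma evCZ_eq0 a A : a != 0 -> evC (a *: A) P = 0 -> evC A P = 0.
Proof.
move=> a0; rewrite (evalvZ _ _ _ Pd) => /eqP.
by rewrite mulf_eq0 (negbTE (expf_neq0 d a0)) => /eqP.
Qed.

Lemma evC_upper_pair z s w : ccone z -> 0 < complex.Im s ->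
  0 <= complex.Im w -> evC (s *: cx e + w *: cx z) P != 0.
Proof.
move=> Kz s0 u0.
have sn0 : s != 0 by apply: contraTneq s0 => ->; rewrite ltxx.
have [->|un0] := eqVneq w 0; first by rewrite scale0r addr0 evC_e_neq0.
apply/eqP => H; have {H}/Kz r0 : evC (cx z + (s / w) *: cx e) P = 0.
  by apply: (evCZ_eq0 un0); rewrite scalerDr scalerA [w * _]mulrC (divfK un0) addrC.
have : s = w * (s / w) by rewrite mulrC (divfK un0).
move: r0; move: (s / w) => r; rewrite lecE.
case: r w u0 {un0} => [r1 r2] [u1 u2] /= u0.
move=> /andP[/eqP <- r10] sE.
by move: s0; rewrite sE /= mulr0 add0r ltNge mulr_ge0_le0.
Qed.

(* Homotopy [x |-> r x], starting from [P (s e + w z)]. *)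
Lemma evC_upper_interior z x s w : ccone z -> evR z P != 0 ->
  0 < complex.Im s -> 0 < complex.Im w ->
  evC (s *: cx e + cx x + w *: cx z) P != 0.
Proof.
move=> Kz Pz s0; apply: (dhomog_homotopy Pd) => [|r r01 u|u u0].
- by rewrite evC_real_eq0.
- suff -> : s *: cx e + r%:C *: cx x + u%:C *: cx z
      = cx (r *: x + u *: z) + s *: cx e by apply: evC_nonreal; rewrite gt_eqF.
  by rewrite map_mxD !map_mxZ [RHS]addrC addrA.
- exact: evC_upper_pair.
Qed.

(** Adding [c e] translates the zeros by [- c], so [0] is no longer one of them. The shifted point
    can then provide the nonzero leading coefficient of a homotopy. *)
Lemma ccone_shift z (c : R) : ccone z -> 0 < c ->
  ccone (z + c *: e) /\ evR (z + c *: e) P != 0.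
Proof.
move=> Kz c0.
have H s : evC (cx (z + c *: e) + s *: cx e) P = 0 -> c%:C + s <= 0.
  by rewrite map_mxD map_mxZ -addrA -scalerDl => /Kz.
split=> [s /H cs|]; first by rewrite (le_trans _ cs)// lerDr ler0c ltW.
rewrite -evC_real_eq0; apply/eqP => cz.
have := H 0; rewrite scale0r addr0 cz addr0 -[0]/(0%:C) lecR => /(_ erefl).
by rewrite leNgt c0.
Qed.

Lemma cconeZ z (c : R) : ccone z -> 0 <= c -> ccone (c *: z).
Proof.
move=> Kz; rewrite le_eqVlt => /predU1P[<-|c0] s.
  rewrite scale0r map_mx0 add0r => /eqP; apply: contraTT => s0.
  by apply: evC_e_neq0; apply: contra s0 => /eqP->.
have cC : c%:C != 0 by rewrite -[0]/(0%:C) (inj_eq (@complexI R)) gt_eqF.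
rewrite map_mxZ => H; have /Kz : evC (cx z + (s / c%:C) *: cx e) P = 0.
  by apply: (evCZ_eq0 cC); rewrite scalerDr scalerA [_ * (s / _)]mulrC (divfK cC).
by rewrite pmulr_lle0 // invr_gt0 ltcR.
Qed.

Lemma ccone0 : ccone 0.
Proof.
move=> s; rewrite map_mx0 add0r => /eqP; apply: contraTT => s0.
by apply: evC_e_neq0; apply: contra s0 => /eqP->.
Qed.

Lemma evC_upper z x t s : ccone z -> 0 <= complex.Im t -> 0 < complex.Im s ->
  evC (cx x + t *: cx z + s *: cx e) P != 0.
Proof.
move=> Kz; rewrite le_eqVlt => /predU1P[t0|t0] s0.
  have -> : cx x + t *: cx z = cx (x + complex.Re t *: z).
    rewrite map_mxD map_mxZ; congr (_ + _ *: _).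
    by case: t t0 => a b /= <-.
  by apply: evC_nonreal; rewrite gt_eqF.
(* Write [t z + s e = t (z + c e) + (s - t c) e]; this [c] leaves [Im (s - t c) = Im s / 2 > 0], and
   [evC_upper_interior] applies to [z + c e]. *)
pose c := complex.Im s / (complex.Im t + complex.Im t).
have c0 : 0 < c by rewrite divr_gt0 ?addr_gt0.
have [Kz' Pz'] := ccone_shift Kz c0.
have st : 0 < complex.Im (s - t * c%:C).
  have -> : complex.Im (s - t * c%:C) = complex.Im s - complex.Im t * c.
    by case: (s) (t) => [s1 s2] [t1 t2] /=; rewrite mulr0 add0r.
  have -> : complex.Im t * c = complex.Im s / 2 by rewrite /c; field; apply: lt0r_neq0; lra.
  by lra.
have := evC_upper_interior x Kz' Pz' st t0.
congr (is_true (evC _ P != 0)); apply/rowP => i.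
rewrite !mxE !rcD !rcM; ring.
Qed.

(** Thus [z + c e] is again a direction of hyperbolicity. The lower half plane reduces to the upper
    one by homogeneity, changing the signs of [x] and [t]. *)
Lemma evC_nonreal_shift z (c : R) x t : ccone z -> 0 < c ->
  complex.Im t != 0 -> evC (cx x + t *: cx (z + c *: e)) P != 0.
Proof.
move=> Kz c0.
have H y u : 0 < complex.Im u -> evC (cx y + u *: cx (z + c *: e)) P != 0.
  move=> u0; rewrite map_mxD map_mxZ scalerDr scalerA addrA.
  apply: evC_upper => //; first exact: ltW.
  by case: u u0 => u1 u2 u0 /=; rewrite mulr0 add0r mulr_gt0.
rewrite neq_lt => /orP[t0|]; last exact: H.
apply/eqP => xt.
have /eqP[] : evC (cx (- x) + (- t) *: cx (z + c *: e)) P != 0.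
  by apply: H; rewrite raddfN oppr_gt0.
by rewrite map_mxN scaleNr -opprD -scaleN1r (evalvZ _ _ _ Pd) xt mulr0.
Qed.

(* Homotopy [i e ~> i b], along [i ((1 - r) e + r b)]. *)
Lemma cconeD a b : ccone a -> ccone b -> ccone (a + b).
Proof.
move=> Ka Kb s Ps; have := Preal Ps; rewrite realE => /orP[|]; last exact: id.
rewrite le_eqVlt => /predU1P[<-|/gt0_complexP[c c0 sE]]; first exact: lexx.
have i0 : 'i%C != 0 :> C by rewrite eq_complex /= oner_eq0 andbF.
have [Ka' Pa'] := ccone_shift Ka c0.
(* At a positive zero [s = c], the point [i (a + b + c e)] is a zero; it is the end of this homotopy
   at [w = i]. *)
have := @dhomog_homotopy d P ('i%C *: cx e) ('i%C *: cx (b - e)) (cx (a + c *: e)) Pd.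
rewrite evC_real_eq0 => /(_ Pa') H.
have /eqP[] : evC ('i%C *: cx e + 'i%C *: cx (b - e) + 'i%C *: cx (a + c *: e)) P != 0.
  apply: H => [r /andP[r0 r1] u|w w0|]; last exact: ltr01.
  - apply/eqP => rP.
    (* Divide by [i]. For [u = 0] this leaves a point of the cone shifted along [e]; otherwise a
       real point plus a nonreal multiple of the direction [a + c e]. *)
    have [u0|u0] := eqVneq u 0.
      have [_ /eqP[]] : ccone (r *: b + (1 - r) *: e) /\ evR (r *: b + (1 - r) *: e) P != 0.
        by apply: ccone_shift; [exact: cconeZ|rewrite subr_gt0].
      apply/eqP; rewrite -evC_real_eq0; apply/eqP/(evCZ_eq0 i0); rewrite -[RHS]rP u0.
      by congr (evC _ P); apply/rowP => j; rewrite !mxE !(rcD, rcM, rcN); ring.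
    have /eqP[] : evC (cx (r *: b + (1 - r) *: e) + (- ('i%C * u%:C)) *: cx (a + c *: e)) P != 0.
      by apply: evC_nonreal_shift => //=; rewrite mul0r mul1r add0r oppr_eq0.
    apply: (evCZ_eq0 i0); rewrite -[RHS]rP.
    have iiu : 'i%C * - ('i%C * u%:C) = u%:C by rewrite mulrN mulrA -expr2 sqr_i mulN1r opprK.
    congr (evC _ P); rewrite [LHS]scalerDr; congr (_ + _); last by rewrite scalerA iiu.
    by apply/rowP => j; rewrite !mxE !(rcD, rcM, rcN); ring.
  - by apply: evC_upper_pair.
rewrite -!scalerDr -!map_mxD [e + _]addrC subrK addrA [b + a]addrC.
have <- : cx (a + b) + s *: cx e = cx (a + b + c *: e).
  by rewrite sE [RHS]map_mxD map_mxZ.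
by rewrite (evalvZ _ _ _ Pd) Ps mulr0.
Qed.

(** * Taylor expansion along [e] and its lowest term *)

Local Notation T := (taylor_coef P e).

Lemma evC_taylor A s :
  evC (A + s *: cx e) P = \sum_(k < d.+1) evC A (T k) * s ^+ k.
Proof.
rewrite -horner_line (horner_coef_wide _ (line_lead _ _ _ Pd).1).
by apply: eq_bigr => k _; rewrite (evalv_taylor_coef (real_complex R)).
Qed.

Lemma evC_taylor_gt A k : (d < k)%N -> evC A (T k) = 0.
Proof.
move=> dk; rewrite (evalv_taylor_coef (real_complex R)).
by rewrite nth_default// (leq_trans (line_lead _ _ _ Pd).1).
Qed.

Lemma evC_taylor_deg A : evC A (T d) = evC (cx e) P.
Proof. by rewrite (evalv_taylor_coef (real_complex R)) (line_lead _ _ _ Pd).2. Qed.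

(* [P (A + w z + s e)] divided by [s ^+ m] tends to [T m (A + w z)] as [s]
   tends to [0], with a leading coefficient in [w] that does not depend on [s]. *)
Lemma taylor_limit m z A : evC (cx z) (T m) != 0 ->
    (forall k w, (k < m)%N -> evC (A + w *: cx z) (T k) = 0) ->
    (forall (s : R) w, 0 < s <= 1 -> 0 < complex.Im w ->
       evC (A + w *: cx z + ('i%C * s%:C) *: cx e) P != 0) ->
  forall w, 0 < complex.Im w -> evC (A + w *: cx z) (T m) != 0.
Proof.
move=> zm low up w w0.
have md : (m <= d)%N by rewrite leqNgt; apply: contra zm => /evC_taylor_gt->.
have i0 : 'i%C != 0 :> C by rewrite eq_complex /= oner_eq0 andbF.
pose U k : {poly C} := line (real_complex R) A (cx z) (T k).
(* [f s] is [s^-m P (A + w z + s e)] as a polynomial in [w], extended to [s = 0], where it is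
   [T m (A + w z)]. *)
pose f (s : C) := \sum_(k < (d - m).+1) s ^+ k *: U (m + k)%N.
have fE s u : (f s).[u] * s ^+ m = evC (A + u *: cx z + s *: cx e) P.
  rewrite evC_taylor -(subnKC md) -addnS big_split_ord /= big1 ?add0r; last first.
    by move=> k _; rewrite low// mul0r.
  rewrite /f horner_sum mulr_suml; apply: eq_bigr => k _.
  by rewrite hornerZ horner_line exprD mulrAC [RHS]mulrC [s ^+ m * _]mulrC.
(* [T (m + k)] has degree [d - m - k], so only [k = 0] contributes to the coefficient of degree
   [d - m]. *)
have [sf fd] : (forall s, size (f s) <= (d - m).+1)%N /\
    (forall s, (f s)`_(d - m) = evC (cx z) (T m)).
  have lead k := line_lead (real_complex R) A (cx z) (taylor_coef_dhomog e (m + k) Pd).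
  split=> s.
    apply: (leq_trans (size_sum _ _ _)); apply/bigmax_leqP => k _.
    by rewrite (leq_trans (size_scale_leq _ _))// (leq_trans (lead k).1)// ltnS; lia.
  rewrite coef_sum big_ord_recl expr0 scale1r addn0 big1 ?addr0.
    by have := (lead 0%N).2; rewrite addn0.
  move=> k _; rewrite coefZ nth_default ?mulr0// (leq_trans (lead _).1)// lift0.
  by have := ltn_ord k; move: (nat_of_ord k) => j; lia.
(* For fixed [w], this is [f] along the imaginary axis. By [norm_horner_ge] it has a lower bound
   independent of [s] in [(0, 1]], which survives at [s = 0]. *)
pose c : {poly C} := \poly_(k < (d - m).+1) (evC (A + w *: cx z) (T (m + k)%N) * 'i%C ^+ k).
have cE s : c.[s] = (f ('i%C * s)).[w].
  rewrite horner_poly horner_sum; apply: eq_bigr => k _.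
  by rewrite hornerZ horner_line exprMn -mulrA mulrC.
suff : c.[0] != 0.
  by rewrite horner_coef0 coef_poly /= addn0 expr0 mulr1.
apply: poly_nonzero_limit.
have : 0 < `|evC (cx z) (T m)| * (complex.Im w)%:C ^+ (d - m).
  by rewrite mulr_gt0 ?normr_gt0// exprn_gt0// ltcR.
case/gt0_complexP => r r0 rE; exists r => // s s01; rewrite -rE cE.
have is0 : 'i%C * s%:C != 0.
  by rewrite mulf_neq0// eq_complex /= eqxx andbT gt_eqF//; case/andP: s01.
rewrite -(fd ('i%C * s%:C)); apply: norm_horner_ge => //.
- by rewrite fd.
- move=> u u0; have := up s u s01 u0; rewrite -fE.
  by apply: contraNneq => ->; rewrite mul0r.
- exact: ltW.
Qed.

(** * The lowest Taylor coefficient on a subspace *)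

Section Restriction.
Variables (L : {vspace 'rV[R]_n}) (m : nat) (z : 'rV[R]_n).
Hypotheses (Lz : z \in L) (Kz : ccone z) (zm : evR z (T m) != 0).
Hypothesis low : forall k x, (k < m)%N -> x \in L -> evR x (T k) = 0.

Lemma evC_low k x w : (k < m)%N -> x \in L ->
  evC (cx x + w *: cx z) (T k) = 0.
Proof.
move=> km Lx; rewrite -horner_map_line.
rewrite (@poly_eq0_injective _ (line idfun x z (T k)) (fun j => j%:R)).
- by rewrite rmorph0 horner0.
- by move=> i j /eqP; rewrite eqr_nat => /eqP.
- by move=> j; rewrite horner_line low// memvD// memvZ.
Qed.

Lemma evC_lowZ k x a : (k < m)%N -> x \in L -> evC (a *: cx x) (T k) = 0.
Proof.
move=> km Lx; rewrite (evalvZ _ _ _ (taylor_coef_dhomog e k Pd)).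
by rewrite evC_real low// mulr0.
Qed.

Lemma taylor_upper x w : x \in L -> 0 < complex.Im w ->
  evC (cx x + w *: cx z) (T m) != 0.
Proof.
move=> Lx; apply: taylor_limit => [|k u km|s u /andP[s0 _] u0].
- by rewrite evC_real_eq0.
- exact: evC_low.
- apply: evC_upper => //; first exact: ltW.
  by rewrite /= mul0r mul1r add0r.
Qed.

(** This gives hyperbolicity of [T m] on [L] with respect to [z]: the lower half plane is excluded
    by [taylor_upper] at [- x]. *)
Lemma taylor_real x w : x \in L ->
  evC (cx x + w *: cx z) (T m) = 0 -> w \is Num.real.
Proof.
move=> Lx xw.
have {xw} : complex.Im w = 0.
  apply/eqP; rewrite eq_le !leNgt; apply/andP; split; apply/negP => w0.
    by have := taylor_upper Lx w0; rewrite xw eqxx.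
  have : evC (cx (- x) + (- w) *: cx z) (T m) != 0.
    by apply: taylor_upper; rewrite ?memvN// raddfN oppr_gt0.
  rewrite map_mxN scaleNr -opprD -scaleN1r.
  by rewrite (evalvZ _ _ _ (taylor_coef_dhomog e m Pd)) xw mulr0 eqxx.
by case: w => a b /= ->; rewrite complex_real.
Qed.

(** A positive zero [w] would put [i w] in the upper half plane, so [taylor_limit] is applied with
    [A = i x]. For [u = u1 + i u2] one has [i x + u z = u1 z + i (x + u2 z)], and [x + u2 z] is in
    the cone. *)
Lemma taylor_ccone x w : x \in L -> ccone x ->
  evC (cx x + w *: cx z) (T m) = 0 -> w <= 0.
Proof.
move=> Lx Kx xw; have := taylor_real Lx xw.
rewrite realE => /orP[|]; last exact: id.
rewrite le_eqVlt => /predU1P[<-|/gt0_complexP[c c0 wE]]; first exact: lexx.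
have ic : 0 < complex.Im ('i%C * w) by rewrite wE /= mul0r mul1r add0r.
have low' k u : (k < m)%N -> evC ('i%C *: cx x + u *: cx z) (T k) = 0.
  move=> km; have := evC_low (- 'i%C * u) km Lx.
  have -> : 'i%C *: cx x + u *: cx z = 'i%C *: (cx x + (- 'i%C * u) *: cx z).
    by rewrite scalerDr scalerA mulrA mulrN -expr2 sqr_i opprK mul1r.
  by rewrite (evalvZ _ _ _ (taylor_coef_dhomog e k Pd)) => ->; rewrite mulr0.
have zm' : evC (cx z) (T m) != 0 by rewrite evC_real_eq0.
suff /eqP[] : evC ('i%C *: cx x + ('i%C * w) *: cx z) (T m) != 0.
  rewrite -scalerA -scalerDr (evalvZ _ _ _ (taylor_coef_dhomog e m Pd)) xw.
  by rewrite mulr0.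
apply: (taylor_limit zm' low' _ ic) => s [u1 u2] /andP[s0 _] /= u20.
have -> : 'i%C *: cx x + (u1 +i* u2) *: cx z = cx (u1 *: z) + 'i%C *: cx (x + u2 *: z).
  rewrite map_mxD !map_mxZ scalerDr scalerA addrCA; congr (_ + _).
  by rewrite -scalerDl; congr (_ *: _); rewrite [LHS]complexE.
apply: evC_upper; rewrite /= ?ler01 ?mul0r ?mul1r ?add0r//.
by apply: cconeD => //; apply: cconeZ => //; exact: ltW.
Qed.

(* Homotopy along the segment from [z] to [y]: [P (i x + w e)] vanishes to order
   exactly [m] at [w = 0] for every [x] on the segment except possibly [y]. *)
Lemma ccone_taylor y : y \in L ->
  (forall c : R, 0 < c -> evR (y + c *: z) (T m) != 0) -> ccone y.
Proof.
move=> Ly yz s Ps; have := Preal Ps.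
rewrite realE => /orP[|]; last exact: id.
rewrite le_eqVlt => /predU1P[<-|/gt0_complexP[c c0 sE]]; first exact: lexx.
pose F := pencil ('i%C *: cx z) ('i%C *: cx (y - z)) (cx e) P.
have i0 : 'i%C != 0 :> C by rewrite eq_complex /= oner_eq0 andbF.
have segE (r : R) : 'i%C *: cx z + r%:C *: ('i%C *: cx (y - z)) = 'i%C *: cx (z + r *: (y - z)).
  by rewrite [in RHS]map_mxD map_mxZ [RHS]scalerDr !scalerA [r%:C * _]mulrC.
have Lseg (r : R) : z + r *: (y - z) \in L by rewrite memvD// memvZ// memvB.
have md : (m <= d)%N.
  rewrite leqNgt; apply: contra zm => /evC_taylor_gt H.
  by rewrite -evC_real_eq0 H.
have [sF Fd] := pencil_lead ('i%C *: cx z) ('i%C *: cx (y - z)) (cx e) Pd.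
have Flow k : (k < m)%N -> F`_k = 0.
  move=> km; apply: (@poly_eq0_injective _ _ (fun j => (j%:R : R)%:C)).
    by move=> i j /complexI/eqP; rewrite eqr_nat => /eqP.
  by move=> j; rewrite coef_pencil segE evC_lowZ.
(* Dividing by [w ^ m] removes the zeros at the origin, which would lie on the real axis, and keeps
   the leading coefficient [P (e)]. *)
pose D := drop_poly m F.
have DF w r : D.[w%:P].[r] * w ^+ m = F.[w%:P].[r].
  rewrite -[in RHS](poly_take_drop m F) hornerD hornerM hornerXn.
  have -> : take_poly m F = 0.
    by apply/polyP => k; rewrite coef_take_poly coef0; case: ifP => // /Flow.
  by rewrite horner0 add0r hornerM -rmorphXn hornerC.
have D0 r : D.[0%:P].[r] = (F`_m).[r].
  by rewrite polyC0 horner_coef0 coef_drop_poly.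
have Dm (r : R) : 0 <= r < 1 -> (F`_m).[r%:C] != 0.
  move=> /andP[r0 r1]; rewrite coef_pencil segE.
  rewrite (evalvZ _ _ _ (taylor_coef_dhomog e m Pd)) mulf_neq0 ?expf_neq0//.
  rewrite evC_real_eq0; move: r0; rewrite le_eqVlt => /predU1P[<-|r0].
    by rewrite scale0r addr0.
  (* Up to a positive factor, the point is [y + c z] with [c = (1 - r) / r > 0], as in the
     hypothesis on [y]. *)
  have -> : z + r *: (y - z) = r *: (y + ((1 - r) / r) *: z).
    rewrite [RHS]scalerDr scalerA mulrCA divff ?gt_eqF// mulr1 scalerBr scalerBl scale1r.
    by rewrite addrCA.
  rewrite (evalvZ _ _ _ (taylor_coef_dhomog e m Pd)).
  apply: mulf_neq0; first by apply/expf_neq0/lt0r_neq0.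
  by apply: yz; rewrite divr_gt0// subr_gt0.
have Drot x w : evC ('i%C *: cx x + w *: cx e) P = 'i%C ^+ d * evC (cx x + (- 'i%C * w) *: cx e) P.
  rewrite -(evalvZ _ _ _ Pd) scalerDr scalerA mulrA mulrN -expr2 sqr_i opprK.
  by rewrite mul1r.
have sD : (size D <= (d - m).+1)%N.
  by rewrite size_drop_poly -subSn// leq_sub2r.
have Dd : D`_(d - m) = (evC (cx e) P)%:P by rewrite coef_drop_poly subnK.
have e0 : evC (cx e) P != 0 by rewrite evC_real_eq0.
have s0 : 0 < complex.Im ('i%C * s) by rewrite sE /= mul0r mul1r add0r.
suff : D.[('i%C * s)%:P].[1] != 0.
  have : D.[('i%C * s)%:P].[1] * ('i%C * s) ^+ m = 0.
    rewrite DF horner_pencil scale1r -scalerDr -map_mxD [z + _]addrC subrK Drot.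
    by rewrite mulrA mulNr -expr2 sqr_i opprK mul1r Ps mulr0.
  move=> /eqP; rewrite mulf_eq0 => /orP[->//|].
  rewrite expf_eq0 => /andP[_ /eqP is0].
  by move: s0; rewrite is0 ltxx.
apply: (half_plane_homotopy sD Dd e0) s0.
- move=> r r01 u; have [->|u0] := eqVneq u 0; first by rewrite D0 Dm.
  suff : F.[u%:C%:P].[r%:C] != 0 by apply: contraNneq; rewrite -DF => ->; rewrite mul0r.
  rewrite horner_pencil segE Drot; apply: mulf_neq0; first exact: expf_neq0.
  by apply: evC_nonreal; rewrite /= oppr0 mul0r mulN1r add0r oppr_eq0.
- move=> w w0; have [->|wn0] := eqVneq w 0.
    by rewrite D0; apply: (Dm 0); rewrite lexx ltr01.
  suff : F.[w%:P].[0] != 0 by apply: contraNneq; rewrite -DF => ->; rewrite mul0r.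
  rewrite horner_pencil scale0r addr0 Drot; apply: mulf_neq0; first exact: expf_neq0.
  apply: contra wn0 => /eqP/Kz; case: w w0 => w1 w2 /= w20.
  rewrite lecE /= eq_complex /= oppr0 !mul0r sub0r add0r !mulN1r opprK.
  rewrite eq_sym oppr_eq0 => /andP[/eqP-> w2le]; rewrite eqxx /=.
  by rewrite eq_le w2le w20.
Qed.

Lemma taylor_ccone_sub x (t : R) : x \in L -> ccone x ->
  evR (t *: z - x) (T m) = 0 -> 0 <= t.
Proof.
move=> Lx Kx xt; suff : (- t)%:C <= 0 by rewrite -[0]/(0%:C) lecR oppr_le0.
apply: (taylor_ccone Lx Kx).
have -> : cx x + (- t)%:C *: cx z = cx (- 1 *: (t *: z - x)).
  by rewrite -map_mxZ -map_mxD scaleN1r opprB scaleNr.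
by rewrite evC_real (evalvZ _ _ _ (taylor_coef_dhomog e m Pd)) xt mulr0.
Qed.

Lemma ccone_taylor_sub y : y \in L ->
  (forall t : R, evR (t *: z - y) (T m) = 0 -> 0 <= t) -> ccone y.
Proof.
move=> Ly yz; apply: ccone_taylor => // c c0; apply/eqP => yc.
have /yz : evR ((- c) *: z - y) (T m) = 0.
  rewrite scaleNr -opprD addrC -scaleN1r.
  by rewrite (evalvZ _ _ _ (taylor_coef_dhomog e m Pd)) yc mulr0.
by rewrite oppr_ge0 leNgt c0.
Qed.

End Restriction.
End Cone.
End Complexification.

Local Open Scope classical_set_scope.

(** * The intersection of two hyperbolicity cones *)

Section ConvexCone.
Variables (R : realFieldType) (V : vectType R) (K : set V).
Hypotheses (K0 : K 0) (KD : forall x y, K x -> K y -> K (x + y)).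
Hypothesis KZ : forall (c : R) x, 0 <= c -> K x -> K (c *: x).

(** A finite family in [K] whose span has maximal dimension spans all of [K]. In a combination of
    its members, the terms with negative coefficients are collected in [b]. *)
Lemma convex_cone_span : exists L : {vspace V},
  (forall x, K x -> x \in L) /\
  (forall x, x \in L -> exists a b, [/\ K a, K b & x = a - b]).
Proof.
pose Q k := `[< exists s : seq V, (forall v, v \in s -> K v) /\ \dim <<s>> = k >].
have Q0 : exists k, Q k.
  by exists 0%N; apply/asboolP; exists [::]; split=> //; rewrite span_nil dimv0.
have Qub k : Q k -> (k <= \dim {:V})%N.
  by move=> /asboolP[s [_ <-]]; rewrite dimvS ?subvf.
have [k /asboolP[s [sK <-]] smax] := ex_maxnP Q0 Qub.
exists <<s>>%VS; split=> [x Kx|{smax}].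
  have /smax : Q (\dim <<x :: s>>).
    apply/asboolP; exists (x :: s); split=> // v; rewrite inE => /predU1P[->//|].
    exact: sK.
  rewrite span_cons => dle.
  have /eqP sE : <<s>>%VS == (<[x]> + <<s>>)%VS by rewrite eqEdim addvSr.
  by rewrite sE (subvP (addvSl _ _))// memv_line.
elim: s sK => [|v s IH] sK x.
  by rewrite span_nil memv0 => /eqP->; exists 0, 0; rewrite subr0.
have Kv : K v by apply: sK; rewrite inE eqxx.
rewrite span_cons => /memv_addP[_ /vlineP[c ->] [y /IH]].
case=> [u us|a [b [Ka Kb ->]] ->]; first by apply: sK; rewrite inE us orbT.
have [c0|c0] := leP 0 c.
  by exists (c *: v + a), b; split=> //; [apply: KD => //; exact: KZ|rewrite addrA].
exists a, (- c *: v + b); split=> //.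
  by apply: KD => //; apply: KZ => //; rewrite oppr_ge0 ltW.
by rewrite opprD scaleNr opprK addrCA.
Qed.

End ConvexCone.

Section Assembly.
Variables (R : realType) (n : nat).
Local Notation C := R[i].
Local Notation cx := (map_mx (real_complex R)).
Local Notation evC := (evalv (real_complex R)).
Local Notation evR := (evalv (@idfun R)).
Local Notation T := taylor_coef.

Lemma homogeneous_poly_linear (V : vectType R) (f : {linear V -> 'rV[R]_n}) d
    (Q : {mpoly R[n]}) : Q \is d.-homog ->
  homogeneous_poly d (fun y => evR (f y) Q).
Proof.
move=> Qd; pose b := vbasis {:V}.
(* The coordinate [i] of [f], as a linear form in the coordinates of the basis [b]. *)
pose l i : {mpoly R[\dim {:V}]} := \sum_(j < \dim {:V}) f b`_j 0 i *: 'X_j.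
exists (\dim {:V}), b, (mmap (@mpolyC _ R) l Q); split.
- exact: vbasisP.
- pose K k (x y : {mpoly R[\dim {:V}]}) := x \is k.-homog.
  apply: (@mmap_dhomog_ind _ _ _ _ K _ _ (@mpolyC _ R) l d Q) => //.
  + by move=> k; exact: dhomog0.
  + by move=> k x1 x2 y1 y2; exact: dhomogD.
  + exact: dhomog1.
  + by move=> k j x1 x2 y1 y2; exact: dhomogM.
  + by move=> c; rewrite /K -alg_mpolyC; apply/dhomogZ/dhomog1.
  + move=> i; apply: rpred_sum => j _; apply: rpredZ.
    by rewrite dhomogX; apply/eqP/mdeg1.
- move=> x; symmetry; apply: (rmorph_mmap (g := meval (coord b ^~ x))) => [c|i].
    exact: mevalC.
  rewrite /= [in RHS](coord_basis (vbasisP _) (memvf x)) !raddf_sum summxE.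
  by apply: eq_bigr => j _; rewrite /= mevalZ mevalXU linearZ mxE mulrC.
Qed.

Definition hyperbolic_mpoly d (P : {mpoly R[n]}) e :=
  [/\ P \is d.-homog, evR e P != 0 &
      forall x s, evC (cx x + s *: cx e) P = 0 -> s \is Num.real].

(** By homogeneity, [P (x - t e)] and [P (t e - x)] agree up to sign, so the two conventions for
    zeros correspond under [s = - t]. *)
Lemma hyperbolic_mpolyP (p : 'rV[R]_n -> R) e : hyperbolic p e ->
  exists d P, hyperbolic_mpoly d P e /\ hyperbolicity_cone p e = ccone P e.
Proof.
case=> -[d /homogeneous_poly_rVP[P Pd pE]] pe real.
have pE' x : p x = evR x P by rewrite pE.
have Preal x s : evC (cx x + s *: cx e) P = 0 -> s \is Num.real.
  have [u uE ureal] := real (- x).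
  have -> : evC (cx x + s *: cx e) P = (map_poly (real_complex R) u).[s].
    rewrite -horner_map_line; congr (map_poly _ _).[_].
    apply/eqP; rewrite -subr_eq0; apply/eqP.
    apply: (@poly_eq0_injective _ _ (fun j => j%:R)) => [i j /eqP|j].
      by rewrite eqr_nat => /eqP.
    by rewrite hornerD hornerN horner_line uE pE' opprK [x + _]addrC subrr.
  move=> us; have := ureal s; rewrite rootE us eqxx => /(_ isT).
  by case: s {us} => a b /= ->; rewrite complex_real.
exists d, P; split; first by split=> //; rewrite -pE' gt_eqF.
have rE x (t : R) : evC (cx x + (- t)%:C *: cx e) P = 0 <-> p (t *: e - x) = 0.
  have -> : cx x + (- t)%:C *: cx e = cx (- 1 *: (t *: e - x)).
    by rewrite -map_mxZ -map_mxD scaleN1r opprB scaleNr.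
  rewrite evC_real (evalvZ _ _ _ Pd) -pE'; split=> [/complexI/eqP|->].
    by rewrite mulf_eq0 expf_eq0 oppr_eq0 oner_eq0 andbF => /eqP.
  by rewrite mulr0.
apply/seteqP; split=> x /= xK.
  move=> s xs; have := Preal _ _ xs => /complex_realP[t sE].
  move: xs; rewrite sE -[t]opprK => /rE /xK t0.
  by rewrite -[0]/(0%:C) lecR oppr_le0.
by move=> t /rE /xK; rewrite -[0]/(0%:C) lecR oppr_le0.
Qed.

(** A least such [m] exists because [T d] is the nonzero constant [P (e)]. *)
Lemma ex_vanishing_order d P e (K : set 'rV[R]_n) : hyperbolic_mpoly d P e -> K 0 ->
  exists m z, [/\ K z, evR z (T P e m) != 0 &
    forall k x, (k < m)%N -> K x -> evR x (T P e k) = 0].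
Proof.
move=> [Pd Pe _] K0.
pose Q m := `[< exists2 z, K z & evR z (T P e m) != 0 >].
have Q0 : exists m, Q m.
  exists d; apply/asboolP; exists 0 => //.
  by rewrite -evC_real_eq0 (evC_taylor_deg _ Pd) evC_real_eq0.
have [m /asboolP[z Kz zm] mmin] := ex_minnP Q0.
exists m, z; split=> // k x km Kx; apply/eqP; apply: contraTT km => xk.
by rewrite -leqNgt; apply: mmin; apply/asboolP; exists x.
Qed.

(** The polynomial [t |-> Q (a + t b)] vanishes at all natural numbers, hence also at [t = -1]. *)
Lemma vanish_sub (K : set 'rV[R]_n) Q a b :
    (forall x y, K x -> K y -> K (x + y)) ->
    (forall (c : R) x, 0 <= c -> K x -> K (c *: x)) ->
    (forall x, K x -> evR x Q = 0) -> K a -> K b ->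
  evR (a - b) Q = 0.
Proof.
move=> KD KZ KQ Ka Kb; rewrite -[b]scale1r -scaleNr -horner_line.
rewrite (@poly_eq0_injective _ (line idfun a b Q) (fun j => j%:R)) ?horner0//.
  by move=> i j /eqP; rewrite eqr_nat => /eqP.
by move=> j; rewrite horner_line KQ//; apply: KD => //; apply: KZ.
Qed.

Lemma ex_common_nonzero (K : set 'rV[R]_n) Q1 Q2 z1 z2 :
    (forall x y, K x -> K y -> K (x + y)) ->
    (forall (c : R) x, 0 <= c -> K x -> K (c *: x)) ->
    K z1 -> K z2 -> evR z1 Q1 != 0 -> evR z2 Q2 != 0 ->
  exists z, [/\ K z, evR z Q1 != 0 & evR z Q2 != 0].
Proof.
move=> KD KZ Kz1 Kz2 z1Q z2Q.
pose f Q := line idfun z1 (z2 - z1) Q.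
(* Infinitely many points of [(0, 1]]: some [u j] avoids the zeros of both restrictions, and the
   corresponding convex combination of [z1] and [z2] stays in [K]. *)
pose u j : R := (j.+1%:R)^-1.
have [j fj] : exists j, (f Q1 * f Q2).[u j] != 0.
  apply: contrapT => H.
  have : f Q1 * f Q2 = 0.
    apply: (@poly_eq0_injective _ _ u) => [i j /invr_inj/eqP|j].
      by rewrite eqr_nat => /eqP[].
    by apply/eqP; apply: contrapT => /negP ?; apply: H; exists j.
  move=> /eqP; rewrite mulf_eq0 => /orP[]/eqP f0.
    have := horner_line idfun z1 (z2 - z1) Q1 0.
    by rewrite -/(f Q1) f0 horner0 scale0r addr0 => z0; rewrite -z0 eqxx in z1Q.
  have := horner_line idfun z1 (z2 - z1) Q2 1.
  by rewrite -/(f Q2) f0 horner0 scale1r addrC subrK => z0; rewrite -z0 eqxx in z2Q.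
exists (z1 + u j *: (z2 - z1)).
move: fj; rewrite hornerM mulf_eq0 negb_or !horner_line => /andP[-> ->]; split=> //.
have -> : z1 + u j *: (z2 - z1) = (1 - u j) *: z1 + u j *: z2.
  by rewrite scalerBr scalerBl scale1r addrA addrAC.
apply: KD; apply: KZ => //; last by rewrite invr_ge0.
by rewrite subr_ge0 invf_le1 ?ler1n ?ltr0n.
Qed.

End Assembly.

Theorem corollary3p5 (R : realType) (n : nat)
    (p1 p2 : 'rV[R]_n -> R) (e1 e2 : 'rV[R]_n)
    (hp1 : hyperbolic p1 e1) (hp2 : hyperbolic p2 e2) :
  is_hyperbolicity_cone
    (hyperbolicity_cone p1 e1 `&` hyperbolicity_cone p2 e2).
Proof.
have [d1 [P1 [H1 ->]]] := hyperbolic_mpolyP hp1.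
have [d2 [P2 [H2 ->]]] := hyperbolic_mpolyP hp2.
have [P1d P1e P1r] := H1; have [P2d P2e P2r] := H2.
set K := _ `&` _.
have K0 : K 0 by split; [exact: ccone0 P1d P1e | exact: ccone0 P2d P2e].
have KD x y : K x -> K y -> K (x + y).
  move=> [x1 x2] [y1 y2].
  by split; [exact: cconeD P1d P1e P1r _ _ x1 y1 | exact: cconeD P2d P2e P2r _ _ x2 y2].
have KZ (c : R) x : 0 <= c -> K x -> K (c *: x).
  move=> c0 [x1 x2].
  by split; [exact: cconeZ P1d P1e _ _ x1 c0 | exact: cconeZ P2d P2e _ _ x2 c0].
have [L [KL LK]] := convex_cone_span K0 KD KZ.
have [m1 [z1 [Kz1 z1P low1]]] := ex_vanishing_order H1 K0.
have [m2 [z2 [Kz2 z2P low2]]] := ex_vanishing_order H2 K0.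
have [z [Kz zP1 zP2]] := ex_common_nonzero KD KZ Kz1 Kz2 z1P z2P.
have Lz := KL _ Kz.
have {}low1 k x : (k < m1)%N -> x \in L -> evalv idfun x (taylor_coef P1 e1 k) = 0.
  move=> km /LK[a [b [Ka Kb ->]]].
  by apply: (vanish_sub KD KZ _ Ka Kb) => y; apply: low1.
have {}low2 k x : (k < m2)%N -> x \in L -> evalv idfun x (taylor_coef P2 e2 k) = 0.
  move=> km /LK[a [b [Ka Kb ->]]].
  by apply: (vanish_sub KD KZ _ Ka Kb) => y; apply: low2.
pose T1 := taylor_coef P1 e1 m1; pose T2 := taylor_coef P2 e2 m2.
(* Scaling the product by its own value at [z] makes [q] equal to [c ^ 2 > 0] there. *)
pose c := evalv idfun z (T1 * T2).
have c0 : c != 0 by rewrite /c evalvM mulf_neq0.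
pose q (y : subvs_of L) := evalv idfun (vsval y) (c *: (T1 * T2)).
have qE y : q y = c * (evalv idfun (vsval y) T1 * evalv idfun (vsval y) T2).
  by rewrite /q evalv_scale evalvM.
have q0 y : q y = 0 -> evalv idfun (vsval y) T1 = 0 \/ evalv idfun (vsval y) T2 = 0.
  move/eqP; rewrite qE mulf_eq0 (negbTE c0) mulf_eq0 /=.
  by case/orP => /eqP; [left|right].
have zE : vsval (vsproj L z) = z by rewrite vsprojK.
exists L, (vsproj L z), q; split; first split.
- have Td : c *: (T1 * T2) \is ((d1 - m1) + (d2 - m2)).-homog.
    by apply/dhomogZ/dhomogM; apply: taylor_coef_dhomog.
  exists ((d1 - m1) + (d2 - m2))%N; exact: (homogeneous_poly_linear vsval Td).
- by rewrite qE zE -evalvM -expr2 lt_def sqr_ge0 sqrf_eq0 c0.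
- move=> x; set l := fun T => line idfun (- vsval x) z T.
  exists (c *: (l T1 * l T2)) => [t|w].
    by rewrite qE linearB linearZ /= zE hornerZ hornerM !horner_line addrC.
  have Lx : - vsval x \in L by rewrite memvN subvsP.
  rewrite /root map_polyZ rmorphM hornerZ hornerM !horner_map_line.
  rewrite !mulf_eq0 -[0]/((0 : R)%:C) (inj_eq (@complexI R)) (negbTE c0) /=.
  have wR : w \is Num.real -> complex.Im w = 0 by case: w => a b; rewrite complex_real => /eqP.
  case/orP => /eqP H; apply: wR.
    exact: (taylor_real P1d P1e P1r Lz Kz.1 zP1 low1 Lx H).
  exact: (taylor_real P2d P2e P2r Lz Kz.2 zP2 low2 Lx H).
apply/seteqP; split=> x.
  move=> Kx; have Lx := KL _ Kx; exists (vsproj L x); last by rewrite vsprojK.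
  move=> t /q0; rewrite linearB linearZ /= zE vsprojK// => -[].
    exact: (taylor_ccone_sub P1d P1e P1r Lz Kz.1 zP1 low1 Lx Kx.1).
  exact: (taylor_ccone_sub P2d P2e P2r Lz Kz.2 zP2 low2 Lx Kx.2).
(* A zero of either factor is a zero of [q], so each of the two memberships follows separately. *)
move=> [y yK <-]; have Ly := subvsP y.
have yz t : q (t *: vsproj L z - y) = c *
    (evalv idfun (t *: z - vsval y) T1 * evalv idfun (t *: z - vsval y) T2).
  by rewrite qE linearB linearZ /= zE.
split.
  apply: (ccone_taylor_sub P1d P1e P1r Lz Kz.1 zP1 low1 Ly) => t yt.
  by apply: yK; rewrite yz yt mul0r mulr0.
apply: (ccone_taylor_sub P2d P2e P2r Lz Kz.2 zP2 low2 Ly) => t yt.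
by apply: yK; rewrite yz yt !mulr0.
Qed.
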